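(* Let $G$ be a permutation graph. Then either $\tau(G)\le 4$, or $G$ is (isomorphic to) the Petersen graph.
   Context: A cubic graph $G$ is a permutation graph if it has a $2$-factor which is the union of two chordless cycles $C$ and $C'$. For a bridgeless cubic graph $G$, the perfect matching index $\tau(G)$ is the minimum number of perfect matchings of $G$ whose union is $E(G)$. *)

(* Defs.v *)
From HB Require Import structures.
From mathcomp Require Import all_boot.

Set Implicit Arguments.
Unset Strict Implicit.
Unset Printing Implicit Defensive.

Record sgraph := SGraph {
  vertex :> finType;
  adj : rel vertex;
  adj_sym : symmetric adj;
  adj_irr : irreflexive adj }.

Definition edges (G : sgraph) : {set {set G}} :=
  [set [set x.1; x.2] | x : G * G & adj x.1 x.2].

Definition isomorphic (G H : sgraph) : Prop :=
  exists2 f : G -> H, bijective f & forall x y, adj (f x) (f y) = adj x y.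

Definition cubic (G : sgraph) : Prop :=
  forall x : G, #|[set y | adj x y]| = 3.

(* A k-factor, given by its edge set: a spanning k-regular subgraph. *)
Definition factor (G : sgraph) (k : nat) (F : {set {set G}}) : bool :=
  (F \subset edges G) && [forall x : G, #|[set e in F | x \in e]| == k].

Definition perfect_matching (G : sgraph) (M : {set {set G}}) : bool :=
  factor 1 M.

(* A cycle is the cyclic sequence of its distinct vertices; the bound on the
   length rules out a single edge traversed back and forth, which [ucycle]
   alone would accept. *)
Definition is_cycle (G : sgraph) (c : seq G) : Prop :=
  ucycle (@adj G) c /\ 2 < size c.

Definition cycle_edges (G : sgraph) (c : seq G) : {set {set G}} :=
  [set [set x; next c x] | x in c].

Definition chordless (G : sgraph) (c : seq G) : Prop :=
  forall x y : G, x \in c -> y \in c -> adj x y -> [set x; y] \in cycle_edges c.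

Definition permutation_graph (G : sgraph) : Prop :=
  cubic G /\
  exists c c' : seq G,
    [/\ is_cycle c /\ chordless c, is_cycle c' /\ chordless c',
        [disjoint c & c'] & factor 2 (cycle_edges c :|: cycle_edges c')].

Definition perfect_matching_cover (G : sgraph) (Ms : {set {set {set G}}}) : bool :=
  [forall M in Ms, perfect_matching M] && (cover Ms == edges G).

(* [perfect_matching_index G t] says that tau(G) is defined and equal to t.
   A relation is used because a graph with an edge in no perfect matching
   has no cover, and so no index. *)
Definition perfect_matching_index (G : sgraph) (t : nat) : Prop :=
  (exists2 Ms : {set {set {set G}}}, perfect_matching_cover Ms & #|Ms| = t) /\
  forall Ms : {set {set {set G}}}, perfect_matching_cover Ms -> t <= #|Ms|.

(* The Petersen graph as the Kneser graph K(5,2). *)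
Definition petersen_vertex : finType := {A : {set 'I_5} | #|A| == 2}.

Definition petersen_adj : rel petersen_vertex :=
  fun A B => [disjoint val A & val B].

Lemma petersen_adj_sym : symmetric petersen_adj.
Proof. by move=> A B; rewrite /petersen_adj disjoint_sym. Qed.

Lemma petersen_adj_irr : irreflexive petersen_adj.
Proof.
move=> A; rewrite /petersen_adj -setI_eq0 setIid -cards_eq0.
by rewrite (eqP (valP A)).
Qed.

Definition petersen : sgraph := SGraph petersen_adj_sym petersen_adj_irr.

(* Main.v *)
Require Import Defs.
From mathcomp Require Import all_boot zify.

Set Implicit Arguments.
Unset Strict Implicit.
Unset Printing Implicit Defensive.

(** Let [n] be the common length of the two chordless cycles.  If [n] is even,
    the spokes and two alternating matchings of the rims cover every edge.  If
    [n] is odd, each rim carries a tournament: [a -> b] when the cyclic gap from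
    [a] to [b] is odd.  For a spoke [u], let [M_u] be the perfect matching whose
    only spoke is [u].  If three spokes form a cyclic triangle in the tournaments
    of both rims, all cyclic gaps between them are odd, and [M_u], [M_v], [M_w]
    together with the set of all spokes cover every edge.

    Suppose no such triple exists, and transport the tournament of the second
    rim to the first.  It is locally transitive, and the arcs between consecutive
    vertices of the first rim all have the same direction, say [i -> i+1].  For
    [n >= 7], an arc [i+3 -> i] would persist under [i |-> i+1] and make
    [i, i+3, i+6] a forbidden triple.  So [i -> i+3] for all [i], whence by
    induction [i -> i+j] for [0 < j < n], contradicting [i-1 -> i].  The case
    [n = 3] is trivial, and for [n = 5] the only surviving permutations are
    those of the Petersen graph. *)

(** * The odd-gap tournament on a cycle of odd length *)

(** For [a, b < n] with [n] odd: the cyclic gap from [a] to [b] modulo [n] is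
    odd. The value does not depend on [n]. *)
Definition odd_gap (a b : nat) := (a != b) && ((a < b) == odd (a + b)).

Lemma odd_gap_asym a b : odd_gap a b -> ~~ odd_gap b a.
Proof. rewrite /odd_gap; lia. Qed.

Lemma odd_gap_total a b : a != b -> odd_gap a b || odd_gap b a.
Proof. rewrite /odd_gap; lia. Qed.

(** Measured from [a] around an odd cycle, out-neighbours lie at odd offsets, where every arc runs
    from the larger offset to the smaller. The same holds at the even offsets of the in-neighbours,
    treated next. *)
Lemma odd_gap_out_acyclic a b c d :
  odd_gap a b -> odd_gap a c -> odd_gap a d -> odd_gap b c -> odd_gap c d ->
  ~~ odd_gap d b.
Proof. 
rewrite /odd_gap !oddD.
case: (odd a); case: (odd b); case: (odd c); case: (odd d) => /=; lia.
Qed.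

Lemma odd_gap_in_acyclic a b c d :
  odd_gap b a -> odd_gap c a -> odd_gap d a -> odd_gap b c -> odd_gap c d ->
  ~~ odd_gap d b.
Proof.
rewrite /odd_gap !oddD.
case: (odd a); case: (odd b); case: (odd c); case: (odd d) => /=; lia.
Qed.

Definition csucc n a := if a.+1 == n then 0 else a.+1.

Lemma odd_gap_csucc n z : odd n -> 1 < n -> z < n -> odd_gap z (csucc n z).
Proof.
rewrite /odd_gap /csucc => on n1 zn.
by case: (z.+1 =P n) => E; rewrite !oddD /=; case: (boolP (odd z)); lia.
Qed.

Lemma csucc_odd_gap n z u : odd n -> z < n -> u < n -> odd_gap u z -> odd_gap (csucc n z) u.
Proof.
rewrite /odd_gap /csucc => on zn un.
case: (z.+1 =P n) => E; rewrite !oddD /=;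
  by case: (boolP (odd u)); case: (boolP (odd z)); lia.
Qed.

(** For [n] odd, an odd gap is at most [n - 2], so one more step gives an even gap and stops short
    of [a]. With [csucc_alt_rev], this makes the rim edges alternate in a matching with a single
    spoke. *)
Lemma csucc_alt n a b : odd n -> a < n -> b < n -> a != b -> odd_gap a b ->
  (csucc n b != a) && ~~ odd_gap a (csucc n b).
Proof. rewrite /odd_gap /csucc; case: (b.+1 =P n); lia. Qed.

Lemma odd_gap_mod n i a : odd n -> 0 < a < n -> odd_gap (i %% n) ((i + a) %% n) = odd a.
Proof.
move=> on an; have i_n : i %% n < n by rewrite ltn_mod; lia.
have -> : (i + a) %% n = if i %% n + a < n then i %% n + a else i %% n + a - n.
  rewrite -modnDml; case: ifP => h; first by rewrite modn_small.
  have {1}-> : i %% n + a = (i %% n + a - n) + n by lia.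
  by rewrite modnDr modn_small //; lia.
by rewrite /odd_gap; case: ifP; lia.
Qed.

(** * Excluding rims of odd length at least 7 *)

Section ForwardTournament.

(** Indices are naturals read modulo [n], so shifts need no reduction. [R] stands for the tournament
    of the second rim pulled back to the first; [R_triple] and [R_triple_rev] forbid its cyclic
    triangles on indices whose gaps [a], [b], [n - a - b] are all odd. *)
Variables (n : nat) (R : rel nat).
Hypothesis n_odd : odd n.
Hypothesis R_asym : forall i j, R i j -> ~~ R j i.
Hypothesis R_in : forall a b c d,
  R b a -> R c a -> R d a -> R b c -> R c d -> ~~ R d b.
Hypothesis R_total : forall i d, 0 < d < n -> R i (i + d) || R (i + d) i.
Hypothesis R_next : forall i,
  exists2 d, 0 < d < n & R i (i + d) /\ forall u, R u i -> R (i + d) u.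
Hypothesis R_per : forall i j, R i (j + n) = R i j.
Hypothesis R_triple : forall i a b, odd a -> odd b -> a + b < n ->
  R i (i + a) -> R (i + a) (i + a + b) -> ~~ R (i + a + b) i.
Hypothesis R_triple_rev : forall i a b, odd a -> odd b -> a + b < n ->
  R (i + a) i -> R (i + a + b) (i + a) -> ~~ R i (i + a + b).

(** The successor [w] of [i+1] in the second rim dominates every in-neighbour of
    [i+1]: if [i] and [i+2] were both in-neighbours, one of the triangles
    [i, i+1, w] and [i+1, i+2, w] would be forbidden. *)
Lemma R_step i : 2 < n -> R i i.+1 -> R i.+1 i.+2.
Proof.
move=> n2 Ri; apply: contraT => nR; have Ri2 : R i.+2 i.+1.
  by have := R_total i.+1 (d := 1); rewrite addn1 (negbTE nR); apply; lia.
have [d dn [Rd /[dup] Rdu /(_ _ Ri) Rdi]] := R_next i.+1.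
have {Rdu} Rdi2 := Rdu _ Ri2.
have [od | ed] := boolP (odd d).
  have dn1 : d != n.-1 by apply/eqP => E; lia.
  by have := @R_triple i 1 d; rewrite addn1 Rdi; lia.
have := @R_triple_rev i.+1 1 d.-1; rewrite !addn1.
have -> : i.+2 + d.-1 = i.+1 + d; lia.
Qed.

Hypothesis n_gt6 : 6 < n.
Hypothesis R_fwd : forall i, R i i.+1.

Lemma R_even2 i : R i (i + 2).
Proof.
have := @R_triple i 1 1; rewrite !addn1 !R_fwd.
have := R_total i (d := 2); rewrite addn2; lia.
Qed.

(** Otherwise [i], [i + 1], [i + e] form a forbidden triangle, with odd gaps 1 and [e - 1]. *)
Lemma R_even_left i e : ~~ odd e -> 2 < e < n -> R (i + e) i -> R (i + e) i.+1.
Proof.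
move=> oe en Rei; have := @R_triple i 1 e.-1; have := R_total i.+1 (d := e.-1).
rewrite addn1; have -> : i.+1 + e.-1 = i + e by lia.
rewrite R_fwd Rei; lia.
Qed.

(** Otherwise the in-neighbours [i], [i + 2], [i + 3] of [i + 4] form a cyclic triangle. *)
Lemma R_gap3_4 i : R (i + 3) i -> R (i + 4) i.
Proof.
move=> R3; apply: contraT => nR4.
have R04 : R i (i + 4) by have := R_total i (d := 4); lia.
have := @R_in (i + 4) i (i + 2) (i + 3); rewrite R3 R04 R_even2.
have := R_even2 (i + 2); rewrite -addnA => ->.
have := R_fwd (i + 2); rewrite -addnS => ->.
have := R_fwd (i + 3); rewrite -addnS => ->.
by move/(_ isT isT isT isT isT).
Qed.

Lemma R_gap3_step i : R (i + 3) i -> R (i.+1 + 3) i.+1.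
Proof.
move=> /R_gap3_4 R4; rewrite addSnnS; apply: R_even_left; lia.
Qed.

(** A backward arc of gap 3 persists under shifts. The arc between [i] and [i + 6] must then point
    forward, or the in-neighbours [i + 3], [i + 4], [i + 6] of [i] would be cyclic; but pointing
    forward it closes a forbidden triangle with gaps 3 and 3. *)
Lemma R_gap3 i : R i (i + 3).
Proof.
apply: contraT => nR; have R3 : R (i + 3) i by have := R_total i (d := 3); lia.
have R4 := R_gap3_4 R3.
have R63 : R (i + 3 + 3) (i + 3).
  by rewrite [i + 3]addn3; do 3!apply: R_gap3_step.
have E : i + 3 + 3 = i + 6 by lia.
have R06 : R i (i + 6).
  apply: contraT => nR6; have R6 : R (i + 6) i by have := R_total i (d := 6); lia.
  have := @R_in i (i + 3) (i + 4) (i + 6).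
  have := R_fwd (i + 3); rewrite -addnS => ->.
  have := R_even2 (i + 4); rewrite -addnA => ->.
  by rewrite R3 R4 R6 -E R63; lia.
by have := @R_triple_rev i 3 3; rewrite E -E R63 E R3 R06; lia.
Qed.

(** Induction two gaps at a time. The even gap comes first, from the triple with gaps 3 and
    [m.*2.+1]; the odd gap below it then follows from acyclicity of the in-neighbours of
    [i + m.*2.+4]. *)
Lemma R_gap j i : 0 < j < n -> R i (i + j).
Proof.
suff H m : m.*2.+2 < n -> forall j, 0 < j <= m.*2.+2 -> forall i, R i (i + j).
  (* As [n] is odd, this choice makes the bound [m.*2.+2] equal to [n - 1]. *)
  move=> jn; apply: (H ((n - 3)./2)); lia.
elim: m => [|m IH] mn {}j jm {}i.
  have [->|->] : j = 1 \/ j = 2 by lia.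
    by rewrite addn1.
  exact: R_even2.
have {}IH : forall j, 0 < j <= m.*2.+2 -> forall i, R i (i + j) by apply: IH; lia.
have even_case k : R k (k + m.*2.+4).
  have := @R_triple k 3 m.*2.+1; have := R_total k (d := m.*2.+4).
  have -> : k + 3 + m.*2.+1 = k + m.*2.+4 by lia.
  have := IH m.*2.+1 _ (k + 3); have -> : k + 3 + m.*2.+1 = k + m.*2.+4 by lia.
  rewrite R_gap3; lia.
have [jlo | jhi] := leqP j m.*2.+2; first by apply: IH; lia.
have [->|->] : j = m.*2.+3 \/ j = m.*2.+4 by lia.
  apply: contraT => nR.
  have Ri : R (i + m.*2.+3) i by have := R_total i (d := m.*2.+3); lia.
  have := @R_in (i + m.*2.+4) i (i + m.*2.+2) (i + m.*2.+3).
  have := R_fwd (i + m.*2.+2); rewrite -addnS => ->.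
  have := R_fwd (i + m.*2.+3); rewrite -addnS => ->.
  have := R_even2 (i + m.*2.+2); rewrite -addnA addn2 => ->.
  by rewrite Ri even_case IH //; lia.
exact: even_case.
Qed.

Lemma forward_false : False.
Proof.
have R1 := @R_gap n.-1 0; have R2 := R_fwd n.-1.
rewrite prednK in R2; last lia.
have := R_per n.-1 0; rewrite add0n R2 => /esym R3.
by have := R_asym R3; rewrite R1 //; lia.
Qed.

End ForwardTournament.

Lemma no_common_triple_false n (q : nat -> nat) : odd n -> 6 < n ->
    (forall i, q i < n) -> (forall i, q (i + n) = q i) ->
    (forall i d, 0 < d < n -> q i != q (i + d)) ->
    (forall v, v < n -> exists i, q i = v) ->
  let R i j := odd_gap (q i) (q j) in
    (forall i a b, odd a -> odd b -> a + b < n ->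
       R i (i + a) -> R (i + a) (i + a + b) -> ~~ R (i + a + b) i) ->
    (forall i a b, odd a -> odd b -> a + b < n ->
       R (i + a) i -> R (i + a + b) (i + a) -> ~~ R i (i + a + b)) ->
  False.
Proof.
move=> on n6 qn qper qinj qsurj R R_triple R_triple_rev.
have q_mod i : q (i %% n) = q i.
  rewrite [in RHS](divn_eq i n); elim: (i %/ n) => [|m IH] //.
  by rewrite mulSn -addnA addnC qper.
have R_total i d : 0 < d < n -> R i (i + d) || R (i + d) i.
  by move=> /qinj dq; rewrite /R odd_gap_total.
have R_next i : exists2 d, 0 < d < n & R i (i + d) /\ forall u, R u i -> R (i + d) u.
  have vn : csucc n (q i) < n by have := qn i; rewrite /csucc; case: eqP; lia.
  (* The offset [d] is chosen so that [i + d] is congruent to [j] modulo [n]. *)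
  have [j qj] := qsurj _ vn; pose d := (j %% n + (n - i %% n)) %% n.
  have qd : q (i + d) = csucc n (q i).
    rewrite -qj -q_mod /d modnDmr -modnDml addnCA subnKC; last first.
      by rewrite ltnW // ltn_mod; lia.
    by rewrite modnDr modn_mod q_mod.
  have Rd : R i (i + d) by rewrite /R qd; apply: odd_gap_csucc => //; lia.
  exists d; last by split=> // u; rewrite /R qd; apply: csucc_odd_gap.
  rewrite ltn_mod lt0n; apply/andP; split; last lia.
  by apply: contraTneq Rd => ->; rewrite addn0 /R /odd_gap eqxx.
have R_asym i j : R i j -> ~~ R j i by apply: odd_gap_asym.
have R_per i j : R i (j + n) = R i j by rewrite /R qper.
have step i : R i i.+1 -> R i.+1 i.+2 by apply: (@R_step n) => //; lia.
have steps i j : R i i.+1 -> R (i + j) (i + j).+1.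
  by move=> Ri; elim: j => [|j IH]; rewrite ?addn0 // addnS; apply: step.
have [R0 | nR0] := boolP (R 0 1).
  apply: (@forward_false n R) => //; last by move=> j; exact: (steps 0 j R0).
  by move=> a b c d; apply: odd_gap_in_acyclic.
have bwd i : R i.+1 i.
  have := R_total i 1; rewrite addn1 => /(_ _)/orP[|Ri|//]; first lia.
  (* A forward arc at [i] propagates up to index [n * i], which is 0 modulo [n], against [nR0]. *)
  have := steps i (n * i - i) Ri; rewrite subnKC; last by rewrite leq_pmull; lia.
  rewrite /R -q_mod -[q _.+1]q_mod -[_.+1]addn1 -modnDml modnMr q_mod.
  by move/(negP nR0).
(* Reversing all arcs swaps the two triple conditions and trades in-neighbourhoods for
   out-neighbourhoods. *)
apply: (@forward_false n (fun i j => R j i)) => //.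
- by move=> i j; apply: R_asym.
- move=> a b c d ab ac ad cb dc; apply/negP => bd.
  by have := odd_gap_out_acyclic ab ad ac bd dc; rewrite [odd_gap _ _]cb.
- by move=> i d /R_total; rewrite orbC.
by move=> i j; rewrite /R qper.
Qed.

(** * Cyclic triangles, and the enumeration for length 5 *)

Definition cyclic3 (a b c : nat) := [&& odd_gap a b, odd_gap b c & odd_gap c a].

(** Three points that cut an odd cycle into three odd gaps, listed in either rotational order. *)
Definition spread (a b c : nat) := cyclic3 a b c || cyclic3 c b a.

(** A point [x] dominated by none of the three would differ from them and have all three as
    out-neighbours, yet out-neighbourhoods are acyclic. This is what lets three single-spoke
    matchings cover the rims. *)
Lemma spread_dominates a b c x :
  spread a b c -> [|| odd_gap a x, odd_gap b x | odd_gap c x].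
Proof.
wlog: a b c / cyclic3 a b c => [cyc | /and3P[ab bc ca] _].
  case/orP=> abc; first by apply: cyc; rewrite /spread abc.
  have: spread c b a by rewrite /spread abc.
  by case/(cyc _ _ _ abc)/or3P=> ->; rewrite ?orbT.
have [<- | /odd_gap_total] := eqVneq a x; first by rewrite ca !orbT.
have [<- | /odd_gap_total] := eqVneq b x; first by rewrite ab.
have [<- | /odd_gap_total] := eqVneq c x; first by rewrite bc orbT.
case/orP=> [-> | xc]; first by rewrite !orbT.
case/orP=> [-> | xb]; first by rewrite !orbT.
case/orP=> [-> // | xa].
by have := odd_gap_out_acyclic xa xb xc ab bc; rewrite ca.
Qed.

Lemma spread_cases5 (q : nat -> nat) :
    (forall i, i < 5 -> q i < 5) ->
    (forall i j, i < j < 5 -> q i != q j) ->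
    (forall i j k, i < j < k -> k < 5 -> spread i j k ->
       ~~ spread (q i) (q j) (q k)) ->
  (forall i, i < 5 -> q ((i + 2) %% 5) = csucc 5 (q i)) \/
  (forall i, i < 5 -> q ((i + 3) %% 5) = csucc 5 (q i)).
Proof.
move=> qn qinj qspr.
pose bad (q : nat -> nat) k :=
  all (fun i => q ((i + k) %% 5) == csucc 5 (q i)) (iota 0 5).
suff: bad q 2 || bad q 3.
  by case/orP=> /allP H; [left | right] => i i5; apply/eqP/H; rewrite mem_iota.
(* These are the five triples whose cyclic gaps are 1, 1, 3 in some order, the only split of 5 into
   three odd gaps. *)
pose good (q : nat -> nat) := [&& uniq (map q (iota 0 5)) &
  all (fun t => ~~ spread (q t.1.1) (q t.1.2) (q t.2))
    [:: (0, 1, 2); (0, 1, 4); (0, 3, 4); (1, 2, 3); (2, 3, 4)]].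
have all5 : all (fun a => all (fun b => all (fun c => all (fun d => all (fun e =>
    let q := nth 0 [:: a; b; c; d; e] in good q ==> bad q 2 || bad q 3)
    (iota 0 5)) (iota 0 5)) (iota 0 5)) (iota 0 5)) (iota 0 5).
  by vm_compute.
have {all5} := all5.
move=> /allP/(_ (q 0)); rewrite mem_iota qn // => /(_ isT).
move=> /allP/(_ (q 1)); rewrite mem_iota qn // => /(_ isT).
move=> /allP/(_ (q 2)); rewrite mem_iota qn // => /(_ isT).
move=> /allP/(_ (q 3)); rewrite mem_iota qn // => /(_ isT).
move=> /allP/(_ (q 4)); rewrite mem_iota qn // => /(_ isT).
have good_q : good (nth 0 [:: q 0; q 1; q 2; q 3; q 4]).
  rewrite /good; apply/andP; split; last by rewrite /= !qspr.
  by rewrite /= !inE !negb_or !qinj.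
by move/implyP/(_ good_q).
Qed.

Lemma csucc_mod n j : 0 < n -> csucc n (j %% n) = j.+1 %% n.
Proof.
move=> n0; have jn : j %% n < n by rewrite ltn_mod.
have -> : j.+1 %% n = (j %% n).+1 %% n by rewrite -[j.+1]addn1 -modnDml addn1.
move: (j %% n) jn => r rn; rewrite /csucc.
by case: eqP => [->|ne]; [rewrite modnn | rewrite modn_small //; lia].
Qed.

Lemma odd_csucc n a : ~~ odd n -> a < n -> odd (csucc n a) = ~~ odd a.
Proof.
by rewrite /csucc => en an; case: (a.+1 =P n) => E /=; case: (boolP (odd a)); lia.
Qed.

Lemma csucc_alt_rev n a b : odd n -> a < n -> b < n -> a != csucc n b ->
  ~~ odd_gap a (csucc n b) -> (a != b) && odd_gap a b.
Proof.
rewrite /odd_gap /csucc => on an bn.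
case: (b.+1 =P n) => E; rewrite !oddD /=;
  by case: (boolP (odd a)); case: (boolP (odd b)); lia.
Qed.

Lemma spread_mod n i a b : odd n -> odd a -> odd b -> a + b < n ->
  spread (i %% n) ((i + a) %% n) ((i + a + b) %% n).
Proof.
move=> on oa ob abn; rewrite /spread /cyclic3 !odd_gap_mod ?oa ?ob //=; try lia.
(* The closing gap [n - (a + b)] is odd, being odd minus even. *)
have -> : i %% n = (i + a + b + (n - (a + b))) %% n.
  by rewrite -[i + a + b]addnA -addnA subnKC ?modnDr //; lia.
rewrite odd_gap_mod; lia.
Qed.

Lemma spread3 a b c : b != c -> a != c -> a != b -> a < 3 -> b < 3 -> c < 3 ->
  spread a b c.
Proof. by case: a b c => [|[|[|a]]] [|[|[|b]]] [|[|[|c]]]. Qed.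

(** * Perfect matchings as involutions *)

Section Mates.

Variable G : sgraph.

(** A perfect matching is handled as the map [m] that exchanges the two ends of each of its
    edges. *)
Definition mate_edges (m : G -> G) : {set {set G}} :=
  [set [set x; m x] | x : G].

Lemma mem_edges (x y : G) : adj x y -> [set x; y] \in edges G.
Proof. by move=> xy; apply/imsetP; exists (x, y); rewrite ?inE. Qed.

Lemma perfect_matching_mate (m : G -> G) :
  involutive m -> (forall x, adj x (m x)) -> perfect_matching (mate_edges m).
Proof.
move=> mK adjm; apply/andP; split.
  by apply/subsetP=> _ /imsetP[x _ ->]; apply: mem_edges.
apply/forallP=> x; rewrite (_ : finset _ = [set [set x; m x]]) ?cards1 //.
apply/setP=> e; rewrite !inE; apply/andP/eqP => [[/imsetP[y _ ->]]|->].
  by rewrite !inE => /orP[] /eqP -> //; rewrite mK setUC.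
by split; [apply: imset_f | rewrite set21].
Qed.

(** The matchings of the [m i] form a cover, so a smallest cover exists; its size is at most [k]
    even if some of the matchings coincide. *)
Lemma index_le_mates k (m : 'I_k -> G -> G) :
    (forall i, involutive (m i)) -> (forall i x, adj x (m i x)) ->
    (forall x y, adj x y -> exists i, m i x = y) ->
  exists2 t, perfect_matching_index G t & t <= k.
Proof.
move=> mK adjm covm; pose Ms := [set mate_edges (m i) | i : 'I_k].
have covMs : perfect_matching_cover Ms.
  apply/andP; split.
    by apply/forall_inP=> _ /imsetP[i _ ->]; apply: perfect_matching_mate.
  rewrite eqEsubset; apply/andP; split; apply/subsetP=> e.
    case/bigcupP=> _ /imsetP[i _ ->] /imsetP[x _ ->].
    exact: mem_edges.
  case/imsetP=> [[x y]] /=; rewrite inE /= => xy ->; have [i <-] := covm x y xy.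
  by apply/bigcupP; exists (mate_edges (m i)); apply: imset_f.
pose P t :=
  [exists Ms : {set {set {set G}}}, perfect_matching_cover Ms && (#|Ms| == t)].
have exP : exists t, P t.
  by exists #|Ms|; apply/existsP; exists Ms; rewrite covMs eqxx.
case: (ex_minnP exP) => t /existsP[Ms' /andP[cov' /eqP card']] min_t.
have {}min_t (N : {set {set {set G}}}) : perfect_matching_cover N -> t <= #|N|.
  by move=> covN; apply: min_t; apply/existsP; exists N; rewrite covN eqxx.
exists t; first by split=> //; exists Ms'.
apply: leq_trans (min_t _ covMs) _.
by rewrite (leq_trans (leq_imset_card _ _)) ?card_ord.
Qed.

End Mates.

(** * Matchings built along the two rims *)

(** [nxt] and [prv] run along the two rims, which [side] tells apart; [spk] swaps
    the ends of the spokes. *)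
Record frame (G : sgraph) := Frame {
  len : nat;
  root : G;
  nxt : G -> G;
  prv : G -> G;
  spk : G -> G;
  side : G -> bool;
  pos : G -> nat;
  len_gt2 : 2 < len;
  side_root : side root;
  pos_root : pos root = 0;
  pos_lt x : pos x < len;
  pos_inj x y : side x = side y -> pos x = pos y -> x = y;
  side_nxt x : side (nxt x) = side x;
  pos_nxt x : pos (nxt x) = csucc len (pos x);
  nxtK : cancel nxt prv;
  prvK : cancel prv nxt;
  spkK : involutive spk;
  side_spk x : side (spk x) = ~~ side x;
  adjE x y : adj x y = [|| y == nxt x, y == prv x | y == spk x] }.

Section Frame.

Variables (G : sgraph) (F : frame G).
Local Notation n := (len F).
Local Notation nxt := (nxt F).
Local Notation prv := (prv F).
Local Notation spk := (spk F).
Local Notation side := (side F).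
Local Notation pos := (pos F).

Lemma side_prv x : side (prv x) = side x.
Proof. by rewrite -{2}(prvK F x) side_nxt. Qed.

Lemma side_iter j x : side (iter j nxt x) = side x.
Proof. by elim: j => //= j; rewrite side_nxt. Qed.

Lemma pos_iter j x : pos (iter j nxt x) = (pos x + j) %% n.
Proof.
elim: j => [|j IH] /=; first by rewrite addn0 modn_small ?pos_lt.
rewrite pos_nxt IH addnS csucc_mod //; have := len_gt2 F; lia.
Qed.

(** [U] marks the ends of the spokes used, and [s] the vertices matched forward along their rim. *)
Definition rim_mate (U s : pred G) x :=
  if U x then spk x else if s x then nxt x else prv x.

Lemma rim_mateK (U s : pred G) :
    (forall x, U (spk x) = U x) ->
    (forall x, ~~ U x -> s x -> ~~ U (nxt x) && ~~ s (nxt x)) ->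
    (forall x, ~~ U x -> ~~ s x -> ~~ U (prv x) && s (prv x)) ->
  involutive (rim_mate U s).
Proof.
move=> Uspk fwd bwd x; rewrite /rim_mate.
have [Ux | nUx] := boolP (U x); first by rewrite Uspk Ux spkK.
have [sx | nsx] := boolP (s x).
  by case/andP: (fwd x nUx sx) => /negbTE -> /negbTE ->; rewrite nxtK.
by case/andP: (bwd x nUx nsx) => /negbTE -> ->; rewrite prvK.
Qed.

Lemma adj_rim_mate U s x : adj x (rim_mate U s x).
Proof.
by rewrite (adjE F) /rim_mate; case: ifP => _; [|case: ifP => _]; rewrite eqxx ?orbT.
Qed.

Lemma adj_spk x : adj x (spk x).
Proof. by rewrite (adjE F) eqxx !orbT. Qed.

Lemma index_le_rims k (m : 'I_k -> G -> G) :
    (forall i, involutive (m i)) -> (forall i x, adj x (m i x)) ->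
    (forall x, exists i, m i x = spk x) -> (forall x, exists i, m i x = nxt x) ->
  exists2 t, perfect_matching_index G t & t <= k.
Proof.
move=> mK adjm mspk mnxt; apply: (index_le_mates mK adjm) => x y.
rewrite (adjE F) => /or3P[] /eqP -> //.
by have [i mi] := mnxt (prv x); exists i; rewrite -[x in LHS](prvK F) -mi mK.
Qed.

Lemma index_even : ~~ odd n -> exists2 t, perfect_matching_index G t & t <= 3.
Proof.
move=> en; pose s b x := odd (pos x) (+) b.
have s_nxt b x : s b (nxt x) = ~~ s b x.
  by rewrite /s pos_nxt odd_csucc ?pos_lt // addNb.
pose m b := rim_mate pred0 (s b).
have mK b : involutive (m b).
  apply: rim_mateK => // x _; first by rewrite s_nxt negbK.
  by rewrite -{1}(prvK F x) s_nxt negbK.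
(* Index 2 falls past the list onto the default [spk], the matching of all spokes. *)
pose ms (i : 'I_3) := nth spk [:: m false; m true] i.
apply: (@index_le_rims 3 ms).
- by case=> [[|[|[|]]]] //= ?; [apply: mK | apply: mK | apply: spkK].
- by case=> [[|[|[|]]]] //= ? x; rewrite ?adj_rim_mate ?adj_spk.
- by move=> x; exists (@Ordinal 3 2 isT).
move=> x; have [sx | nsx] := boolP (s false x).
  by exists (@Ordinal 3 0 isT); rewrite /ms /= /m /rim_mate /= sx.
exists (@Ordinal 3 1 isT); rewrite /ms /= /m /rim_mate /=.
by move: nsx; rewrite /s addbF addbT => ->.
Qed.

(** The end of the spoke at [u] that lies on the rim of [x]. *)
Definition base u x := if side x == side u then u else spk u.

(** The matching whose only spoke is the one at [u]: on each rim, the vertices at odd gap from the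
    end of that spoke are matched forward. *)
Definition near_mate u :=
  rim_mate (fun x => pos x == pos (base u x))
           (fun x => odd_gap (pos (base u x)) (pos x)).

Lemma side_base u x : side (base u x) = side x.
Proof.
rewrite /base; case: eqP => // /eqP; rewrite side_spk.
by case: (side x); case: (side u).
Qed.

Lemma eq_base u x y : side x = side y -> base u x = base u y.
Proof. by rewrite /base => ->. Qed.

Lemma base_spk u x : base u (spk x) = spk (base u x).
Proof.
rewrite /base side_spk; case: (side x); case: (side u) => //=; exact/esym/spkK.
Qed.

Lemma pos_eq_base u x : (pos x == pos (base u x)) = (x == base u x).
Proof.
apply/eqP/eqP => [|->//]; first by apply: (@pos_inj _ F); rewrite side_base.
by rewrite {2}/base side_base -/(base u x).
Qed.

Lemma near_mateK u : odd n -> involutive (near_mate u).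
Proof.
move=> on; apply: rim_mateK => x.
- by rewrite !pos_eq_base base_spk (inj_eq (inv_inj (spkK F))).
- rewrite (eq_base u (side_nxt F x)) pos_nxt eq_sym => neq gap.
  by apply: csucc_alt; rewrite ?pos_lt.
rewrite (eq_base u (side_prv x)) eq_sym.
have -> : pos x = csucc n (pos (prv x)) by rewrite -pos_nxt prvK.
by move=> neq gap; rewrite eq_sym; apply: (csucc_alt_rev on); rewrite ?pos_lt.
Qed.

(** The edge from [x] to its successor lies in the matching of any spoke whose end on that rim has
    odd gap to [x]. By [spread_dominates] one of the three spokes qualifies, and the fourth matching
    consists of all spokes. *)
Lemma index_spread u v w : odd n -> side u -> side v -> side w ->
    spread (pos u) (pos v) (pos w) ->
    spread (pos (spk u)) (pos (spk v)) (pos (spk w)) ->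
  exists2 t, perfect_matching_index G t & t <= 4.
Proof.
move=> on su sv sw spr spr'.
pose ms (i : 'I_4) := nth spk [:: near_mate u; near_mate v; near_mate w] i.
have near_nxt z x : odd_gap (pos (base z x)) (pos x) -> near_mate z x = nxt x.
  by rewrite /near_mate /rim_mate eq_sym => /[dup] /andP[/negbTE -> _] ->.
apply: (@index_le_rims 4 ms).
- by case=> [[|[|[|[|]]]]] //= ?; [apply: near_mateK..| apply: spkK].
- by case=> [[|[|[|[|]]]]] //= ? x; rewrite ?adj_rim_mate ?adj_spk.
- by move=> x; exists (@Ordinal 4 3 isT).
move=> x; have: spread (pos (base u x)) (pos (base v x)) (pos (base w x)).
  by rewrite /base su sv sw; case: (side x).
case/(spread_dominates (pos x))/or3P=> /near_nxt E.
- by exists (@Ordinal 4 0 isT).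
- by exists (@Ordinal 4 1 isT).
by exists (@Ordinal 4 2 isT).
Qed.

(** * The permutation defined by the spokes, and the case of odd length *)

Local Notation vtx j := (iter j nxt (root F)).

Lemma side_vtx j : side (vtx j).
Proof. by rewrite side_iter side_root. Qed.

Lemma pos_vtx j : pos (vtx j) = j %% n.
Proof. by rewrite pos_iter pos_root. Qed.

Lemma vtx_pos x : side x -> vtx (pos x) = x.
Proof.
move=> sx; apply: (@pos_inj _ F); first by rewrite side_vtx sx.
by rewrite pos_vtx modn_small ?pos_lt.
Qed.

Lemma eq_vtx i j : (vtx i == vtx j) = (i == j %[mod n]).
Proof.
apply/eqP/eqP => [/(congr1 pos)|E]; first by rewrite !pos_vtx.
by apply: (@pos_inj _ F); rewrite ?side_vtx // !pos_vtx.
Qed.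

Local Notation perm i := (pos (spk (vtx i))).

Lemma eq_perm i j : (perm i == perm j) = (i == j %[mod n]).
Proof.
rewrite -eq_vtx; apply/eqP/eqP => [|->//] E; apply: (inv_inj (spkK F)).
by apply: (@pos_inj _ F); rewrite ?side_spk ?side_vtx.
Qed.

Lemma perm_surj v : v < n -> exists i, perm i = v.
Proof.
(* Enough steps along the second rim to bring the partner of the root to position [v]. *)
move=> vn; pose y := iter (v + (n - pos (spk (root F)))) nxt (spk (root F)).
have sy : side (spk y) by rewrite side_spk side_iter side_spk side_root.
exists (pos (spk y)); rewrite vtx_pos // spkK pos_iter addnCA subnKC.
  by rewrite modnDr modn_small.
exact/ltnW/pos_lt.
Qed.

Lemma index_or_no_spread : odd n ->
  (exists2 t, perfect_matching_index G t & t <= 4) \/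
  forall i j k, spread (i %% n) (j %% n) (k %% n) ->
    ~~ spread (perm i) (perm j) (perm k).
Proof.
move=> on; pose tri i j k := spread (i %% n) (j %% n) (k %% n) &&
  spread (perm i) (perm j) (perm k).
have [/'exists_'exists_existsP[i [j [k /andP[]]]]|none] :=
  boolP [exists i : 'I_n, exists j : 'I_n, exists k : 'I_n, tri i j k].
  rewrite -!pos_vtx => s1 s2; left.
  exact: (index_spread on (side_vtx i) (side_vtx j) (side_vtx k) s1 s2).
right=> i j k s1; apply: contra none => s2.
have n0 : 0 < n by have := len_gt2 F; lia.
have vmod l : vtx (l %% n) = vtx l by apply/eqP; rewrite eq_vtx modn_mod.
apply/'exists_'exists_existsP.
exists (Ordinal (ltn_pmod i n0)), (Ordinal (ltn_pmod j n0)).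
exists (Ordinal (ltn_pmod k n0)).
by rewrite /tri /= !modn_mod s1 !vmod s2.
Qed.

Lemma odd_len_cases : odd n ->
  (exists2 t, perfect_matching_index G t & t <= 4) \/
  n = 5 /\ ((forall i, i < 5 -> perm ((i + 2) %% 5) = csucc 5 (perm i)) \/
            (forall i, i < 5 -> perm ((i + 3) %% 5) = csucc 5 (perm i))).
Proof.
move=> on; have [|no_spread] := index_or_no_spread on; first by left.
have n2 := len_gt2 F; have perm_lt i : perm i < n by apply: pos_lt.
have perm_neq i d : 0 < d < n -> perm i != perm (i + d).
  move=> dn; rewrite eq_perm -{1}[i]addn0 eqn_modDl mod0n modn_small; lia.
have triple i a b : odd a -> odd b -> a + b < n ->
    ~~ spread (perm i) (perm (i + a)) (perm (i + a + b)).
  by move=> oa ob abn; apply: no_spread; apply: spread_mod.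
have [n6 | n_le6] := ltnP 6 n.
  exfalso; apply: (@no_common_triple_false n (fun i => perm i)) => //.
  - by move=> i; apply/eqP; rewrite eq_perm modnDr.
  - exact: perm_surj.
  - move=> i a b oa ob abn g1 g2; apply: contra (triple i a b oa ob abn) => g3.
    by rewrite /spread /cyclic3 g1 g2 g3.
  move=> i a b oa ob abn g1 g2; apply: contra (triple i a b oa ob abn) => g3.
  by rewrite /spread /cyclic3 g1 g2 g3 orbT.
have [n3 | n5] : n = 3 \/ n = 5 by lia.
  (* For length 3, the three vertices of each rim already form a cyclic triangle. *)
  case/negP: (triple 0 1 1 isT isT n2); move: (perm_lt 0) (perm_lt 1) (perm_lt 2).
  have := perm_neq 0 1; have := perm_neq 0 2; have := perm_neq 1 1.
  rewrite n3 => /(_ isT) + /(_ isT) + /(_ isT); exact: spread3.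
right; split=> //; apply: (@spread_cases5 (fun i => perm i)).
- by move=> i _; rewrite -[X in _ < X]n5.
- by move=> i j ij; rewrite -(@subnKC i j) ?perm_neq; lia.
move=> i j k ij k5 spr; apply: no_spread; rewrite n5 !modn_small //; lia.
Qed.

End Frame.

(** * Recognising the Petersen graph *)

Definition ord5 k : 'I_5 := Ordinal (ltn_pmod k (isT : 0 < 5)).

Lemma eq_ord5 j k : (ord5 j == ord5 k) = (j %% 5 == k %% 5).
Proof. by []. Qed.

(** Label of the [i]-th vertex of the outer pentagon if [b], otherwise of its inner
    partner. *)
Definition kneser_set (b : bool) (i : nat) : {set 'I_5} :=
  if b then [set ord5 i.*2; ord5 i.*2.+1] else [set ord5 i.*2.+2; ord5 i.*2.+4].

Lemma card_kneser_set b i : #|kneser_set b i| == 2.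
Proof. by rewrite /kneser_set; case: b; rewrite cards2 eq_ord5; lia. Qed.

Definition kneser_vertex b i : petersen :=
  exist _ (kneser_set b i) (card_kneser_set b i).

Lemma disjoint_set2 (T : finType) (a b c d : T) :
  [disjoint [set a; b] & [set c; d]] = [&& a != c, a != d, b != c & b != d].
Proof.
by rewrite disjoints_subset subUset !sub1set !inE !negb_or -!andbA.
Qed.

(** With [b] counted as 0 or 1, outer neighbours differ by 1 or 4 and inner ones by 2 or 3. *)
Lemma adj_kneser_vertex b i b' i' : i < 5 -> i' < 5 ->
  adj (kneser_vertex b i) (kneser_vertex b' i') =
  if b == b' then i' \in [:: (i + 2 - b) %% 5; (i + 3 + b) %% 5] else i == i'.
Proof.
rewrite /adj /= /petersen_adj /= /kneser_set.
by case: b b' i i' => [] [] [|[|[|[|[|?]]]]] // [|[|[|[|[|?]]]]] // _ _;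
  rewrite disjoint_set2 !eq_ord5.
Qed.

(** Distinct vertices of the Petersen graph have distinct neighbourhoods, so the adjacency table
    suffices. *)
Lemma kneser_vertex_inj b i b' i' : i < 5 -> i' < 5 ->
  kneser_vertex b i = kneser_vertex b' i' -> b = b' /\ i = i'.
Proof.
move=> i5 i5' E.
pose N (b : bool) (i : nat) (c : bool) (j : nat) :=
  if b == c then j \in [:: (i + 2 - b) %% 5; (i + 3 + b) %% 5] else i == j.
have {}E c j : j < 5 -> N b i c j = N b' i' c j.
  by move=> j5; have := adj_kneser_vertex b c i5 j5; rewrite E adj_kneser_vertex.
have {E} : [seq N b i c j | c <- [:: true; false], j <- iota 0 5] =
           [seq N b' i' c j | c <- [:: true; false], j <- iota 0 5].
  by rewrite /= !E.
by case: b b' i i' i5 i5' => [] [] [|[|[|[|[|?]]]]] // [|[|[|[|[|?]]]]].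
Qed.

Section Petersen.

Variables (G : sgraph) (F : frame G).
Local Notation vtx j := (iter j (nxt F) (root F)).
Local Notation perm i := (pos F (spk F (vtx i))).

Hypothesis len5 : len F = 5.

Definition rung x := pos F (if side F x then x else spk F x).

Lemma rung_lt x : rung x < 5.
Proof. by rewrite -[X in _ < X]len5 pos_lt. Qed.

Lemma rung_spk x : rung (spk F x) = rung x.
Proof. by rewrite /rung side_spk; case: (side F x); rewrite //= spkK. Qed.

Lemma rung_inj x y : side F x = side F y -> rung x = rung y -> x = y.
Proof.
move=> sxy; rewrite /rung -sxy; case: ifP => sx E; first exact: (pos_inj sxy).
by apply: (inv_inj (spkK F)); apply: (@pos_inj _ F); rewrite ?side_spk -?sxy.
Qed.

(** The map reads off [side] and [rung]. The values 2 and 3 of [s] describe the same inner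
    pentagram, traversed in opposite directions. *)
Lemma isomorphic_petersen s : s = 2 \/ s = 3 ->
    (forall i, i < 5 -> perm ((i + s) %% 5) = csucc 5 (perm i)) ->
  isomorphic G petersen.
Proof.
move=> s23 perm_s.
have rung_nxt x : rung (nxt F x) = (rung x + (if side F x then 1 else s)) %% 5.
  have [sx | nsx] := boolP (side F x).
    have rE : rung x = pos F x by rewrite /rung sx.
    rewrite [LHS]/rung side_nxt sx pos_nxt len5 -rE addn1 -csucc_mod //.
    by rewrite modn_small ?rung_lt.
  set j := (_ + _) %% 5; have j5 : j < 5 by rewrite ltn_mod.
  have xE : x = spk F (vtx (rung x)).
    by rewrite /rung (negbTE nsx) vtx_pos ?spkK // side_spk nsx.
  have -> : nxt F x = spk F (vtx j).
    apply: (@pos_inj _ F); first by rewrite side_spk side_vtx side_nxt (negbTE nsx).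
    by rewrite /j perm_s ?rung_lt // -xE pos_nxt len5.
  by rewrite rung_spk /rung side_vtx pos_vtx len5 modn_small.
pose f x := kneser_vertex (side F x) (rung x).
have f_inj : injective f.
  by move=> x y /kneser_vertex_inj[]; rewrite ?rung_lt //; apply: rung_inj.
exists f; last first.
  move=> x y; rewrite adj_kneser_vertex ?rung_lt // (adjE F) !inE.
  have eqE z : (y == z) = (side F y == side F z) && (rung y == rung z).
    by apply/eqP/andP => [->//|[/eqP sE /eqP rE]]; apply: rung_inj.
  have -> : (y == prv F x) = (x == nxt F y).
    by rewrite -(can2_eq (nxtK F) (prvK F)) eq_sym.
  have eqE' z : (x == z) = (side F x == side F z) && (rung x == rung z).
    by apply/eqP/andP => [->//|[/eqP sE /eqP rE]]; apply: rung_inj.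
  rewrite eqE' !eqE !side_nxt side_spk rung_spk !rung_nxt.
  move: (rung_lt x) (rung_lt y) s23 => rx ry.
  by case: (side F x); case: (side F y) => /=; [lia | lia | lia | case=> ->; lia].
apply: inj_card_bij => //.
have -> : #|petersen| = 10.
  rewrite card_sig -[LHS]/#|[pred A : {set 'I_5} | #|A| == 2]| -cardsE.
  by rewrite card_draws card_ord.
(* This injection gives [G] at least ten vertices, so the injective [f] is bijective. *)
pose g (z : bool * 'I_5) := if z.1 then vtx z.2 else spk F (vtx z.2).
have g_inj : injective g.
  have side_g z : side F (g z) = z.1.
    by rewrite /g; case: (z.1); rewrite ?side_spk side_vtx.
  have rung_g z : rung (g z) = z.2.
    rewrite /g; case: (z.1); rewrite ?rung_spk /rung side_vtx pos_vtx len5 modn_small //.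
  move=> z t E; apply/eqP; rewrite -pair_eqE /pair_eq -!side_g E eqxx /=.
  by rewrite -val_eqE /= -!rung_g E.
by have := leq_card g g_inj; rewrite card_prod card_bool card_ord.
Qed.

End Petersen.

(** * From the 2-factor to a frame *)

Lemma index_next (T : eqType) (s : seq T) x :
  uniq s -> x \in s -> index (next s x) s = csucc (size s) (index x s).
Proof.
move=> us xs; rewrite next_nth xs; case: s us xs => [//|y s] us xs.
have := xs; rewrite -index_mem; move: (index x (y :: s)) => i is_lt.
rewrite /csucc; have [e | ne] := eqVneq i.+1 (size (y :: s)).
  by rewrite nth_default /= ?eqxx //; move: e => /= [->].
rewrite -[nth y s i]/(nth y (y :: s) i.+1) index_uniq //.
by rewrite ltn_neqAle ne.
Qed.

Lemma next_neq_prev (T : eqType) (s : seq T) x :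
  uniq s -> 2 < size s -> x \in s -> next s x != prev s x.
Proof.
move=> us s2 xs; apply/eqP => E.
have := congr1 (index^~ s) (next_prev us x); rewrite -E.
rewrite !index_next ?mem_next // /csucc.
have := xs; rewrite -index_mem; move: (index x s) => i.
by case: (i.+1 =P size s) => h; case: eqP; lia.
Qed.

Lemma mem_cycle_edges (G : sgraph) (c : seq G) x y : uniq c ->
  [set x; y] \in cycle_edges c -> x \in c /\ (y = next c x \/ y = prev c x).
Proof.
move=> uc /imsetP[z zc /setP E].
have := (E x, E y, E z, E (next c z)); rewrite !inE !eqxx !orbT /=.
case=> -[[/esym xE /esym yE] zE] nE.
case/orP: xE => /eqP xE; last rewrite xE mem_next.
  rewrite xE; split=> //; left; case/orP: yE => /eqP // yE.
  by move: nE; rewrite xE yE orbb => /eqP ->.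
split=> //; case/orP: yE => /eqP yE; first by right; rewrite yE prev_next.
by left; move: zE; rewrite xE yE orbb => /eqP zE; rewrite -[in RHS]zE.
Qed.

(** The spoke at [x] leads to its third neighbour, which chordlessness forces onto the other cycle.
    Spokes thus inject each cycle into the other, so the lengths agree. *)
Lemma permutation_graph_frame (G : sgraph) :
  permutation_graph G -> inhabited (frame G).
Proof.
case=> cubG [c [c' [[[/andP[cyc_c uc] c2] chl_c]]]].
case=> [[/andP[cyc_c' uc'] c'2] chl_c'] dis fac.
have cover_c x : (x \in c) || (x \in c').
  case/andP: fac => _ /forallP/(_ x)/eqP deg.
  have /card_gt0P[e] :
      0 < #|[set e in cycle_edges c :|: cycle_edges c' | x \in e]| by rewrite deg.
  rewrite !inE => /andP[/orP[] /imsetP[z zc ->]]; rewrite !inE => /orP[] /eqP ->;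
    by rewrite ?mem_next zc ?orbT.
pose side x := x \in c; pose cy x := if side x then c else c'.
have side' x : (x \in c') = ~~ side x.
  have := cover_c x; rewrite /side; case: (boolP (x \in c)) => //= xc _.
  by rewrite (disjointFr dis xc).
have mem_cy x : x \in cy x by rewrite /cy; case: (boolP (side x)); rewrite -?side'.
have cy_uniq x : uniq (cy x) by rewrite /cy; case: ifP.
have cy_size x : 2 < size (cy x) by rewrite /cy; case: ifP.
have cy_cycle x : cycle (@adj G) (cy x) by rewrite /cy; case: ifP.
have side_cy x y : y \in cy x -> side y = side x.
  by rewrite /cy; case: (boolP (side x)); rewrite // side' => _ /negbTE.
have cy_chl x y : y \in cy x -> adj x y -> [set x; y] \in cycle_edges (cy x).
  by have := mem_cy x; rewrite /cy; case: ifP => _ *; [apply: chl_c | apply: chl_c'].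
pose nx x := next (cy x) x; pose pv x := prev (cy x) x.
have side_nx x : side (nx x) = side x by rewrite (@side_cy x) // mem_next.
have side_pv x : side (pv x) = side x by rewrite (@side_cy x) // mem_prev.
have cy_eq x y : side x = side y -> cy x = cy y by rewrite /cy => ->.
have nxK : cancel nx pv.
  by move=> x; rewrite /pv (cy_eq _ _ (side_nx x)) prev_next.
have pvK : cancel pv nx.
  by move=> x; rewrite /nx (cy_eq _ _ (side_pv x)) next_prev.
have adj_nx x : adj x (nx x) by apply: next_cycle.
have adj_pv x : adj x (pv x) by rewrite adj_sym; apply: prev_cycle.
have nx_neq_pv x : nx x != pv x by apply: next_neq_prev.
pose spk x := odflt x [pick y | adj x y && (y \notin [set nx x; pv x])].
have spkP x : adj x (spk x) && (spk x \notin [set nx x; pv x]).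
  rewrite /spk; case: pickP => //= none.
  suff : 3 <= 2 by [].
  (* If the choice failed, the three neighbours of [x] would lie in a two-element set; the default
     in [spk] is therefore never taken. *)
  rewrite -{1}(cubG x) -[X in _ <= X]/(true.+1) -(nx_neq_pv x) -cards2.
  apply/subset_leq_card/subsetP => y; rewrite inE => xy.
  by have := none y; rewrite xy /= => /negbFE.
have adjN x y : adj x y = [|| y == nx x, y == pv x | y == spk x].
  have [adj_s s_notin] := andP (spkP x).
  have: [set spk x; nx x; pv x] == [set z | adj x z].
    rewrite eqEcard cubG -setUA cardsU1 s_notin cards2 nx_neq_pv andbT.
    by apply/subsetP=> z; rewrite !inE => /or3P[] /eqP ->.
  by move/eqP/setP/(_ y); rewrite !inE => <-; rewrite -orbA orbC -orbA.
have side_spk x : side (spk x) = ~~ side x.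
  apply: contraTeq (spkP x); rewrite negb_and -implybE => sE; apply/implyP => adj_s.
  have s_cy : spk x \in cy x.
    rewrite -(@cy_eq (spk x) x) ?mem_cy //.
    by move: sE; case: (side x); case: (side (spk x)).
  have [_ h] := mem_cycle_edges (cy_uniq x) (cy_chl _ _ s_cy adj_s).
  by rewrite negbK !inE; case: h => ->; rewrite eqxx ?orbT.
have spkK : involutive spk.
  move=> x; have /andP[+ _] := spkP x; rewrite adj_sym adjN.
  case/or3P=> /eqP E; last exact/esym.
    by have := side_spk x; rewrite -side_nx -E; case: (side x).
  by have := side_spk x; rewrite -side_pv -E; case: (side x).
have size_le (s t : seq G) : uniq s -> {subset map spk s <= t} -> size s <= size t.
  move=> us sub; rewrite -(size_map spk) uniq_leq_size // map_inj_uniq //.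
  exact: inv_inj.
have size_c : size c' = size c.
  apply/eqP; rewrite eqn_leq !size_le // => _ /mapP[x xc ->].
    by rewrite side' side_spk negbK.
  by rewrite -[_ \in c]/(side _) side_spk -side'.
have cy_len x : size (cy x) = size c by rewrite /cy; case: ifP.
have x0 : {x0 | x0 \in c & index x0 c = 0}.
  by case: (c) c2 => [//|x0 s] _; exists x0; rewrite ?mem_head //= eqxx.
case: x0 => x0 x0c x0_0.
constructor; apply: (@Frame G (size c) x0 nx pv spk side (fun x => index x (cy x))) => //.
- by rewrite /cy /side x0c.
- by move=> x; rewrite -(cy_len x) index_mem.
- move=> x y sE; rewrite (cy_eq _ _ sE) => E.
  by rewrite -(nth_index x (mem_cy x)) (cy_eq _ _ sE) E nth_index.
by move=> x; rewrite (cy_eq _ _ (side_nx x)) index_next // cy_len.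
Qed.

Theorem theorem3p12 (G : sgraph) (hG : permutation_graph G) :
  (exists2 t : nat, perfect_matching_index G t & t <= 4) \/
  isomorphic G petersen.
Proof.
have [F] := permutation_graph_frame hG.
have [on | en] := boolP (odd (len F)); last first.
  by left; have [t tP t3] := index_even en; exists t => //; lia.
have [small | [n5 [E | E]]] := odd_len_cases on; first by left.
  by right; apply: (isomorphic_petersen n5 (or_introl erefl) E).
by right; apply: (isomorphic_petersen n5 (or_intror erefl) E).
Qed.
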